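(* Let $B$ be a standard Brownian motion. For every $a>2$ and $b<1/2$ there is a constant $c$ such that for all $y\ge0$, $$P\Big(\sup_{t>0}\Big(\frac{B(t)^2}{t}-a\log(1+|\log t|)\Big)>y\Big)\le ce^{-by}.$$ *)

(* Defs.v *)
From HB Require Import structures.
From mathcomp Require Import all_boot all_order all_algebra.
From mathcomp Require Import all_classical all_reals all_analysis.
Set Implicit Arguments. Unset Strict Implicit. Unset Printing Implicit Defensive.
Import Order.TTheory GRing.Theory Num.Theory.
Import numFieldNormedType.Exports.
Local Open Scope classical_set_scope.
Local Open Scope ring_scope.

(* Standard (one-dimensional) Brownian motion B : [0,oo) x Omega -> R on the
   probability space (T, P):
   - each B t is a random variable (measurable),
   - B 0 = 0,
   - every sample path t |-> B t w is continuous on [0, +oo),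
   - increments over consecutive disjoint intervals are independent and
     B t - B s ~ N(0, t - s) (standard deviation sqrt (t - s)); both facts are
     packaged as: for 0 <= t_0 < t_1 < ... < t_n and Borel sets A_0..A_{n-1},
     P(forall i < n, B t_{i+1} - B t_i \in A_i) = prod_i N(0, t_{i+1}-t_i)(A_i). *)
Definition is_standard_BM {R : realType} {d : measure_display}
    {T : measurableType d} (P : probability T R) (B : R -> T -> R) : Prop :=
  [/\ (forall t, 0 <= t -> measurable_fun setT (B t)),
      (forall w, B 0 w = 0),
      (forall w, {within [set t : R | 0 <= t], continuous (fun t => B t w)}) &
      (forall (n : nat) (ts : nat -> R) (A : nat -> set R),
          0 <= ts 0%N ->
          (forall i, (i < n)%N -> ts i < ts i.+1) ->
          (forall i, (i < n)%N -> measurable (A i)) ->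
          P (\bigcap_(i in [set i | (i < n)%N])
               [set w | A i (B (ts i.+1) w - B (ts i) w)])
          = \big[*%E/1%E]_(i < n)
               normal_prob 0 (Num.sqrt (ts i.+1 - ts i)) (A i))].

(* Main.v *)
(** Cut (0, oo) into the blocks [e^(nL), e^((n+1)L)] and [e^(-(n+1)L), e^(-nL)],
    n >= 0. On a block with right end point u and with s = e^(-L), B(t)^2 / t is
    at most (s u)^-1 sup_{t <= u} B(t)^2. Levy's maximal inequality on dyadic
    grids, path continuity and the Gaussian tail bound the probability that it
    exceeds z by 6 exp(- s z / 2). On the n-th blocks |log t| >= nL, so the
    level is z = y + a log (1 + nL), and the union bound costs e^(- s y / 2) times the
    sum over n of the (1 + nL)^(- a s / 2). For s < 1 close enough to 1 we have
    a s / 2 > 1, which makes this sum finite, and s / 2 > b. *)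

Require Import Defs.
From HB Require Import structures.
From mathcomp Require Import all_boot all_order all_algebra.
From mathcomp Require Import all_classical all_reals all_analysis.
From mathcomp Require Import measurable_realfun ring lra.
Import Order.TTheory GRing.Theory Num.Theory.
Import numFieldNormedType.Exports.
Local Open Scope classical_set_scope.
Local Open Scope ring_scope.

Set Implicit Arguments.
Unset Strict Implicit.
Unset Printing Implicit Defensive.

(** * Gaussian estimates *)

(* On D the density of N(0, s^2) is at most the stated constant times that of
   N(l, s^2). *)
Lemma normal_prob_half_line (R : realType) (s l : R) (D : set R) :
  0 < s -> measurable D -> (forall x, D x -> 0 <= l * (x - l)) ->
  (normal_prob 0 s D <= (expR (- l ^+ 2 / (s ^+ 2 *+ 2)))%:E)%E.
Proof.
move=> s0 mD Dl; set K := expR _.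
have sn0 : s != 0 by rewrite gt_eqF.
rewrite /normal_prob.
apply: (@le_trans _ _
  (\int[lebesgue_measure]_(x in D) (K%:E * (normal_pdf l s x)%:E))%E).
  apply: ge0_le_integral => //=.
  - by move=> x _; rewrite lee_fin normal_pdf_ge0.
  - by apply/measurable_EFinP/measurable_funTS; exact: measurable_normal_pdf.
  - apply/measurable_EFinP/measurable_funTS.
    by apply: measurable_funM => //; exact: measurable_normal_pdf.
  move=> x /Dl xl; rewrite -EFinM lee_fin !normal_pdfE// mulrCA.
  rewrite ler_wpM2l ?normal_peak_ge0// /normal_fun /K -expRD ler_expR.
  rewrite -mulrDl ler_wpM2r ?invr_ge0 ?mulrn_wge0 ?sqr_ge0//.
  (* Since [x ^+ 2 - l ^+ 2 - (x - l) ^+ 2 = 2 * l * (x - l)], the sign condition on D is exactly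
     what is needed. *)
  nra.
rewrite ge0_integralZl//=; last 3 first.
- by apply/measurable_EFinP/measurable_funTS; exact: measurable_normal_pdf.
- by move=> x _; rewrite lee_fin normal_pdf_ge0.
- by rewrite lee_fin expR_ge0.
rewrite -[leRHS]mule1 lee_wpmul2l ?lee_fin ?expR_ge0//.
exact: (@probability_le1 _ _ _ (normal_prob l s)).
Qed.

Lemma normal_prob_tail (R : realType) (s l : R) : 0 < s -> 0 <= l ->
  (normal_prob 0 s [set x | (l < `|x|)%R]
   <= (2 * expR (- l ^+ 2 / (s ^+ 2 *+ 2)))%:E)%E.
Proof.
move=> s0 l0.
have -> : [set x : R | l < `|x|] = `]l, +oo[ `|` `]-oo, - l[.
  apply/seteqP; split => x /=; rewrite !in_itv/= andbT ltr_normr.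
    by move=> /orP[|]; [left|right; rewrite ltrNr].
  by move=> [->//|]; rewrite ltrNr => ->; rewrite orbT.
apply: (le_trans (measureU2 _ _ _)) => //.
rewrite mulrDl mul1r EFinD leeD//.
  apply: normal_prob_half_line => // x /=; rewrite in_itv/= andbT => /ltW xl.
  by rewrite mulr_ge0// subr_ge0.
rewrite -(sqrrN l) normal_prob_half_line// => x /=; rewrite in_itv/= => /ltW xl.
by rewrite mulr_le0 ?oppr_le0 ?subr_le0.
Qed.

(** The density is even, so the nonnegative half-line carries half of the total mass 1; its
    complement lies in the other half-line. *)
Lemma normal_prob_half (R : realType) (s : R) : 0 < s ->
  ((2^-1)%:E <= normal_prob 0 s [set x | 0 <= x]%R)%E /\
  ((2^-1)%:E <= normal_prob 0 s [set x | x <= 0]%R)%E.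
Proof.
move=> s0; have sn0 : s != 0 by rewrite gt_eqF.
have hge : normal_prob 0 s [set x | 0 <= x]%R = (2^-1)%:E.
  have := integral_normal_pdf 0 s.
  rewrite ge0_symfun_integralT; last 3 first.
  - by move=> x; exact: normal_pdf_ge0.
  - exact: continuous_normal_pdf.
  - by move=> x /=; rewrite !normal_pdfE// /normal_fun !subr0 sqrrN.
  rewrite -/(normal_prob 0 s [set x | 0 <= x]%R).
  have fh : normal_prob 0 s [set x | 0 <= x]%R \is a fin_num.
    by apply: fin_num_measure; rewrite -set_itvcy.
  rewrite -(fineK fh) -EFinM => -[h2]; congr EFin.
  by apply: (mulfI (_ : 2 != 0)) => //; rewrite h2 divff.
split; first by rewrite hge.
rewrite (@le_trans _ _ (normal_prob 0 s (~` [set x | 0 <= x]%R)))//.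
  rewrite probability_setC -?set_itvcy// set_itvcy.
  by rewrite [X in (1 - X)%E]hge -EFinB lee_fin; lra.
apply: le_measure; rewrite ?inE.
- by apply: measurableC; rewrite -set_itvcy.
- by rewrite -set_itvNyc.
- by move=> x /= /negP; rewrite -ltNge => /ltW.
Qed.

(** * Elementary real analysis: the series over the blocks and the barrier *)

Lemma ln_add1_le (R : realType) (z : R) : 0 < z -> 1 + ln z <= z.
Proof. by move=> z0; rewrite -[leRHS]lnK ?posrE// expR_ge1Dx. Qed.

(* Telescoping: each term is at most a multiple of the decrement of
   (1 + n L)^(1 - p). *)
Lemma sum_log_power_bounded (R : realType) (p L : R) : 1 < p -> 0 < L ->
  forall N, \sum_(i < N) expR (- (p * ln (1 + i%:R * L)))
            <= 1 + 1 / ((p - 1) * L).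
Proof.
move=> p1 L0.
have q0 : 0 < (p - 1) * L by rewrite mulr_gt0// subr_gt0.
pose v (i : nat) := expR (- (p * ln (1 + i%:R * L))).
pose u (i : nat) := expR (- ((p - 1) * ln (1 + i%:R * L))).
(* A decrement of a decreasing convex function controls its slope at the right end point only, hence
   the index [i.+1]. The term [v 0 = 1] is left over and gives the leading 1 of the bound. *)
have step i : v i.+1 <= (u i - u i.+1) / ((p - 1) * L).
  rewrite /u /v; set X := 1 + i%:R * L; set Y := 1 + i.+1%:R * L.
  have X0 : 0 < X by rewrite ltr_pwDl// mulr_ge0// ltW.
  have Y0 : 0 < Y by rewrite ltr_pwDl// mulr_ge0// ltW.
  have XY : Y = X + L by rewrite /Y /X -natr1; ring.
  have XYr : 1 + (ln X - ln Y) <= X / Y.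
    by rewrite -ln_div ?posrE// ln_add1_le// divr_gt0.
  have -> : expR (- (p * ln Y)) = expR (- ((p - 1) * ln Y)) / Y.
    rewrite -[in RHS](lnK (x := Y)) ?posrE// -expRN -expRD expRK//.
    by congr expR; ring.
  have -> : expR (- ((p - 1) * ln X))
      = expR (- ((p - 1) * ln Y)) * expR ((p - 1) * (ln Y - ln X)).
    by rewrite -expRD; congr expR; ring.
  have := expR_ge1Dx ((p - 1) * (ln Y - ln X)).
  set eY := expR (- _); set eD := expR _ => hD.
  have eY0 : 0 < eY by exact: expR_gt0.
  rewrite ler_pdivlMr// -[X in _ <= _ - X]mulr1 -mulrBr.
  rewrite -mulrA ler_pM2l//.
  (* This is [ln (X / Y) <= X / Y - 1], rewritten with [Y = X + L]. *)
  have LY : L / Y <= ln Y - ln X.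
    have -> : L / Y = 1 - X / Y by rewrite XY; field; rewrite -XY gt_eqF.
    by lra.
  have : (p - 1) * (L / Y) <= (p - 1) * (ln Y - ln X).
    by rewrite ler_wpM2l// subr_ge0 ltW.
  have -> : Y^-1 * ((p - 1) * L) = (p - 1) * (L / Y) by ring.
  lra.
have u0 : u 0%N = 1 by rewrite /u mul0r addr0 ln1 mulr0 oppr0 expR0.
have sum_le N : \sum_(i < N.+1) v i <= 1 + (1 - u N) / ((p - 1) * L).
  elim: N => [|N IH].
    rewrite big_ord_recl big_ord0 u0 subrr mul0r !addr0.
    by rewrite /v mul0r addr0 ln1 mulr0 oppr0 expR0.
  rewrite big_ord_recr/= (le_trans (lerD IH (step N)))//.
  by rewrite -addrA -mulrDl lerD2l ler_pM2r ?invr_gt0//; lra.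
case=> [|N]; first by rewrite big_ord0 addr_ge0// divr_ge0// ltW.
apply: (le_trans (sum_le N)); rewrite lerD2l ler_pM2r ?invr_gt0//.
by have := expR_gt0 (- ((p - 1) * ln (1 + N%:R * L))); rewrite -/(u N); lra.
Qed.

Lemma continuous_log_barrier (R : realType) (a : R) :
  {in `]0, +oo[, continuous (fun t : R => a * ln (1 + `|ln t|))}.
Proof.
move=> t; rewrite in_itv/= andbT => t0.
apply: cvgM; first exact: cvg_cst.
apply: (@continuous_comp _ _ _ (fun t : R => 1 + `|ln t|) (@ln R)); last first.
  by apply: continuous_ln; rewrite ltr_pwDl.
apply: cvgD; first exact: cvg_cst.
apply: (@continuous_comp _ _ _ (@ln R) Num.norm); first exact: continuous_ln.
exact: norm_continuous.
Qed.

Lemma measurable_norm_gt (R : realType) (x : R) :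
  measurable [set r : R | x < `|r|].
Proof.
have -> : [set r : R | x < `|r|] = setT `&` Num.norm @^-1` `]x, +oo[.
  by apply/seteqP; split => r /=; rewrite in_itv/= andbT => // -[].
exact: normr_measurable.
Qed.

(** * Events of the past, exceedance events and dyadic grids *)

(** A pi-system generating the sigma-algebra of the first k variables. For Brownian increments these
    are the events whose probability [is_standard_BM] prescribes. *)
Definition rectangles {R : realType} {d} {T : measurableType d}
    (X : nat -> T -> R) (k : nat) : set (set T) :=
  [set S | exists2 A : nat -> set R, (forall i, measurable (A i)) &
     S = \bigcap_(i in [set i | (i < k)%N]) [set w | A i (X i w)]].

Lemma rectangles_setI_closed (R : realType) d (T : measurableType d)
    (X : nat -> T -> R) (k : nat) : setI_closed (rectangles X k).
Proof.
move=> _ _ [A mA ->] [C mC ->]; exists (fun i => A i `&` C i).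
  by move=> i; exact: measurableI.
apply/seteqP; split => w /=.
  by move=> [Aw Cw] i ik; split; [exact: Aw|exact: Cw].
by move=> ACw; split => i ik; case: (ACw i ik).
Qed.

Lemma rectangles_measurable (R : realType) d (T : measurableType d)
    (X : nat -> T -> R) (k : nat) :
  (forall i, (i < k)%N -> measurable_fun setT (X i)) ->
  rectangles X k `<=` measurable.
Proof.
move=> mX _ [A mA ->]; apply: bigcap_measurableType => i ik.
by rewrite -[X in measurable X]setTI; exact: mX.
Qed.

Lemma rectangles_setT (R : realType) d (T : measurableType d)
    (X : nat -> T -> R) (k : nat) : rectangles X k setT.
Proof. by exists (fun=> setT) => //; apply/seteqP; split. Qed.

Definition increment {R : realType} {T : Type} (B : R -> T -> R)
    (ts : nat -> R) (i : nat) (w : T) :=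
  B (ts i.+1) w - B (ts i) w.

Definition exceeds {R : realType} {T : Type} (B : R -> T -> R)
    (ts : nat -> R) (x : R) (k : nat) : set T :=
  [set w | exists2 j, (j <= k)%N & x < `|B (ts j) w|].

Definition dyadic {R : realType} (u : R) (m j : nat) : R := j%:R * (u / 2 ^+ m).

(** A countable union over grids stands in for the supremum over all times in [0, u]: it is
    measurable, and continuity from below applies to it. *)
Definition path_exceeds {R : realType} {T : Type} (B : R -> T -> R)
    (u x : R) : set T :=
  \bigcup_m exceeds B (dyadic u m) x (2 ^ m)%N.

Lemma dyadic_approx (R : realType) (u t e : R) :
  0 < u -> 0 <= t <= u -> 0 < e ->
  exists m j, (j <= 2 ^ m)%N /\ `|t - dyadic u m j| < e.
Proof.
move=> u0 /andP[t0 tu] e0.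
have [m um] : exists m, u / 2 ^+ m < e.
  (* With m the integer part of [u / e], [2 ^ m >= m + 1 > u / e]. *)
  exists (Num.truncn (u / e)).
  rewrite ltr_pdivrMr ?exprn_gt0// mulrC -ltr_pdivrMr//.
  by rewrite (lt_le_trans (truncnS_gt _))// -natrX ler_nat ltn_expl//.
pose h := u / 2 ^+ m; have h0 : 0 < h by rewrite divr_gt0// exprn_gt0.
have th : 0 <= t / h by rewrite divr_ge0// ltW.
have /andP[jt tj] := truncn_itv th.
exists m, (Num.truncn (t / h)); split.
  rewrite -(ler_nat R) natrX (le_trans jt)// ler_pdivrMr//.
  by rewrite /h mulrCA divff ?mulr1// expf_neq0.
rewrite /dyadic -/h; move: jt tj; rewrite ler_pdivlMr// ltr_pdivrMr//.
rewrite -natr1 mulrDl mul1r => jt tj.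
rewrite ger0_norm ?subr_ge0// (lt_trans _ um)// -/h; lra.
Qed.

Lemma dyadic_ge0 (R : realType) (u : R) m j : 0 < u -> 0 <= dyadic u m j.
Proof. by move=> u0; rewrite /dyadic mulr_ge0// divr_ge0// ltW. Qed.

(** * Independence of a later increment from the past *)

Section brownian_motion.
Context {R : realType} {d : measure_display} {T : measurableType d}.
Context (P : probability T R) (B : R -> T -> R) (bmB : is_standard_BM P B).

Lemma increment_times_ge0 (ts : nat -> R) k : 0 <= ts 0%N ->
  (forall i, (i < k)%N -> ts i < ts i.+1) ->
  forall i, (i <= k)%N -> 0 <= ts i.
Proof.
move=> t0 tlt; elim => // i IH ik.
by apply: (le_trans (IH (ltnW ik))); exact/ltW/tlt.
Qed.

Lemma measurable_increment (ts : nat -> R) k : 0 <= ts 0%N ->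
  (forall i, (i < k)%N -> ts i < ts i.+1) ->
  forall i, (i < k)%N -> measurable_fun setT (increment B ts i).
Proof.
move=> t0 tlt i ik; case: bmB => mB _ _ _; apply: measurable_funB; apply: mB.
  exact: (increment_times_ge0 t0 tlt).
exact: (increment_times_ge0 t0 tlt (ltnW ik)).
Qed.

(** As functions of S both sides are finite measures. They agree on rectangles, where u serves as
    one more time, and hence on the generated sigma-algebra. *)
Lemma increment_independent (ts : nat -> R) k u E S : 0 <= ts 0%N ->
  (forall i, (i < k)%N -> ts i < ts i.+1) -> ts k < u -> measurable E ->
  <<s rectangles (increment B ts) k >> S ->
  P (S `&` [set w | E (B u w - B (ts k) w)])
  = (normal_prob 0 (Num.sqrt (u - ts k)) E * P S)%E.
Proof.
move=> t0 tlt tku mE sS.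
have tk0 : 0 <= ts k by exact: (increment_times_ge0 t0 tlt).
case: (bmB) => mB _ _ indB.
set F := [set w | _].
have mF : measurable F.
  rewrite -[F]setTI; apply: (measurable_funB _ _) => //; apply: mB => //.
  exact: le_trans (ltW tku).
set q := normal_prob _ _ E.
have fq : q \is a fin_num by exact: fin_num_measure.
have q0 : 0 <= fine q.
  by apply: fine_ge0; exact: (measure_ge0 (normal_prob 0 _)).
pose m1 := mrestr P mF; pose m2 := mscale (NngNum q0) P.
suff : m1 S = m2 S by rewrite /m1/= /m2/= /mscale/= fineK.
apply: (@g_sigma_algebra_measure_unique _ R T (rectangles (increment B ts) k) _
  (fun=> setT)) => //.
- by apply: rectangles_measurable; exact: measurable_increment.
- by move=> _; exact: rectangles_setT.
- by rewrite bigcup_const.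
- exact: rectangles_setI_closed.
- move=> _ [A mA ->].
  rewrite /m1/= /m2/= /mscale/= /mrestr fineK//.
  (* Appending u after [ts k] and E after the first k sides turns the intersection into a rectangle
     with k + 1 sides. *)
  pose ts' i := if (i <= k)%N then ts i else u.
  pose A' i := if (i < k)%N then A i else E.
  have ts'_k : ts' k.+1 = u by rewrite /ts' ltnn.
  have ts'_le i : (i <= k)%N -> ts' i = ts i by rewrite /ts' => ->.
  have ts'lt i : (i < k.+1)%N -> ts' i < ts' i.+1.
    rewrite ltnS leq_eqVlt => /predU1P[->|ik]; first by rewrite ts'_k ts'_le.
    by rewrite !ts'_le ?(ltnW ik)//; exact: tlt.
  have mA' i : measurable (A' i) by rewrite /A'; case: ifP.
  transitivity (P (\bigcap_(i in [set i | (i < k.+1)%N])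
      [set w | A' i (B (ts' i.+1) w - B (ts' i) w)])).
    congr (P _); apply/seteqP; split => w /=.
      move=> [Aw Fw] i /=; rewrite ltnS leq_eqVlt => /predU1P[->|ik].
        by rewrite ts'_k ts'_le// /A' ltnn.
      by rewrite !ts'_le// ?(ltnW ik)// /A' ik; exact: Aw.
    move=> Aw; split => [i /= ik|].
      have := Aw i (ltnW ik).
      by rewrite !ts'_le// ?(ltnW ik)// /A' ik.
    by have := Aw k (ltnSn k); rewrite ts'_k ts'_le// /A' ltnn.
  rewrite (indB k.+1 ts' A')//.
  rewrite big_ord_recr/= ts'_k ts'_le// /A' ltnn muleC; congr (_ * _)%E.
  have -> : P (\bigcap_(i in [set i | (i < k)%N])
      [set w | A i (increment B ts i w)]) = _
    := indB k ts A t0 tlt (fun i _ => mA i).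
  apply: eq_bigr => i _; have ik := ltn_ord i.
  by rewrite ik (ts'_le _ ik) (ts'_le _ (ltnW ik)).
- by rewrite /m1/= /mrestr setTI (le_lt_trans (probability_le1 _ _)) ?ltry.
Qed.

Lemma measurable_abs_gt (t x : R) : 0 <= t ->
  measurable [set w | x < `|B t w|].
Proof.
move=> t0; case: bmB => mB _ _ _.
rewrite -[X in measurable X]setTI.
exact: (mB t t0 measurableT _ (measurable_norm_gt x)).
Qed.

(** As B starts at 0, [B (ts j)] is the sum of the first j increments. *)
Lemma sigma_rectangles_path (ts : nat -> R) k j (D : set R) : ts 0%N = 0 ->
  (j <= k)%N -> measurable D ->
  <<s rectangles (increment B ts) k >> [set w | D (B (ts j) w)].
Proof.
move=> t0 jk mD; case: bmB => _ B0 _ _.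
set G := rectangles _ _; pose GT := g_sigma_algebraType G.
have mincr (i : 'I_j) : measurable_fun (setT : set GT) (increment B ts i).
  move=> _ Y mY; rewrite setTI; apply: sub_sigma_algebra.
  (* All sides but the i-th are the whole line. *)
  exists (fun l : nat => if l == i then Y else setT) => [l|].
    by case: ifP.
  apply/seteqP; split => w /=.
    by move=> Yw l /= lk; case: eqP => // ->.
  by move=> /(_ i)/=; rewrite eqxx; apply; exact: leq_trans (ltn_ord i) jk.
have -> : [set w | D (B (ts j) w)]
    = setT `&` (fun w : GT => \sum_(i < j) increment B ts i w) @^-1` D.
  rewrite setTI; apply/funext => w /=; congr D.
  rewrite -(big_mkord xpredT (fun i => increment B ts i w)).
  by rewrite (telescope_sumr (fun i => B (ts i) w))// t0 B0 subr0.
have := @measurable_sum _ GT R setT.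
by apply.
Qed.

Lemma sigma_rectangles_exceeds (ts : nat -> R) x k l : ts 0%N = 0 ->
  (k <= l)%N -> <<s rectangles (increment B ts) l >> (exceeds B ts x k).
Proof.
move=> t0 kl; set G := rectangles _ _; pose GT := g_sigma_algebraType G.
have -> : exceeds B ts x k = \bigcup_(j in [set j | (j <= k)%N])
    [set w | [set r | x < `|r|] (B (ts j) w)].
  by apply/seteqP; split => w [j]; exists j.
apply: (@bigcup_measurable _ GT) => j /= jk.
apply: (@sigma_rectangles_path ts l j [set r | x < `|r|]) => //.
  exact: leq_trans kl.
exact: measurable_norm_gt.
Qed.

(** * Levy's maximal inequality on a finite grid *)

(* If the path leaves [-x, x] at time ts k, its later increment pushes it
   further away with probability at least 1/2. *)
Lemma passage_prob_le (ts : nat -> R) (x : R) k n S : ts 0%N = 0 ->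
  {homo ts : i j / (i < j)%N >-> i < j} -> 0 <= x -> (k < n)%N ->
  <<s rectangles (increment B ts) k >> S ->
  S `<=` [set w | x < `|B (ts k) w|] ->
  (P S <= 2%:E * P (S `&` [set w | (x < `|B (ts n) w|)%R]))%E.
Proof.
move=> t0 tlt x0 kn sS Sx.
have ts_gt0 : 0 < ts n by rewrite -t0 tlt// (leq_ltn_trans _ kn).
set F := [set w | x < `|B (ts n) w|].
set G := rectangles (increment B ts) k; pose GT := g_sigma_algebraType G.
have subG : <<s G >> `<=` measurable.
  apply: smallest_sub; first exact: sigma_algebra_measurable.
  apply: rectangles_measurable; apply: measurable_increment.
    by rewrite t0.
  by move=> i _; exact: tlt.
(* S is split by the sign of [B (ts k)], which decides the half-line the later increment must hit to
   move the path outwards. *)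
pose Sp := S `&` [set w | `]x, +oo[%classic (B (ts k) w)].
pose Sm := S `&` [set w | `]-oo, - x[%classic (B (ts k) w)].
have sSp : <<s G >> Sp.
  by apply: (@measurableI _ GT) => //; exact: sigma_rectangles_path.
have sSm : <<s G >> Sm.
  by apply: (@measurableI _ GT) => //; exact: sigma_rectangles_path.
pose incr (E : set R) := [set w | E (B (ts n) w - B (ts k) w)].
have mincr E : measurable E -> measurable (incr E).
  case: bmB => mB _ _ _ mE; rewrite -[incr E]setTI.
  apply: measurable_funB => //; apply: mB; first exact/ltW/ts_gt0.
  by case: (k) => [|k']; rewrite ?t0// -t0 ltW// tlt.
have half A E : <<s G >> A -> measurable E ->
    ((2^-1)%:E <= normal_prob 0 (Num.sqrt (ts n - ts k)) E)%E ->
    (P A <= 2%:E * P (A `&` incr E))%E.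
  move=> sA mE hE; rewrite (increment_independent _ _ _ mE sA).
  - rewrite muleA -[leLHS]mul1e lee_wpmul2r//.
    have := @lee_wpmul2l R 2%:E _ _ _ hE; rewrite -EFinM divff//; apply.
    by rewrite lee_fin.
  - by rewrite t0.
  - by move=> i _; exact: tlt.
  - exact: tlt.
have s0 : 0 < Num.sqrt (ts n - ts k) by rewrite sqrtr_gt0 subr_gt0 tlt.
have [hp hm] := normal_prob_half s0.
have mge : measurable [set r : R | 0 <= r] by rewrite -set_itvcy.
have mle : measurable [set r : R | r <= 0] by rewrite -set_itvNyc.
pose X := Sp `&` incr [set r | 0 <= r]; pose Y := Sm `&` incr [set r | r <= 0].
have mX : measurable X by apply: measurableI; [exact: subG|exact: mincr].
have mY : measurable Y by apply: measurableI; [exact: subG|exact: mincr].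
have mS : measurable S by exact: subG.
have mSF : measurable (S `&` F).
  by apply: measurableI => //; exact/measurable_abs_gt/ltW/ts_gt0.
apply: (@le_trans _ _ (P Sp + P Sm)%E).
  rewrite (_ : S = Sp `|` Sm); first by apply: measureU2; exact: subG.
  apply/seteqP; split => w /=; last by move=> [[]|[]].
  move=> Sw; have := Sx _ Sw; rewrite /Sp /Sm /= !in_itv/= andbT ltr_normr.
  by rewrite [X in _ || X]ltrNr => /orP[]; [left|right].
apply: (@le_trans _ _ (2%:E * (P X + P Y))%E).
  by rewrite muleDr ?ge0_adde_def ?inE//; apply: leeD; exact: half.
(* X and Y are disjoint because [x >= 0] forbids [B (ts k)] to be both above x and below - x. Their
   union lies in S and in F. *)
rewrite lee_wpmul2l// -measureU//; last first.
  apply/seteqP; split => // w [[[_ +] _] [[_ +] _]].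
  by rewrite /= !in_itv/= andbT; lra.
apply: le_measure; rewrite ?inE//; first exact: measurableU.
move=> w; rewrite /X /Y /Sp /Sm /F /incr /= !in_itv/= andbT ltr_normr.
by move=> [] [[Sw ?] ?]; split=> //; apply/orP; [left|right]; lra.
Qed.

Lemma measurable_exceeds (ts : nat -> R) x k : (forall i, 0 <= ts i) ->
  measurable (exceeds B ts x k).
Proof.
move=> ts0; rewrite (_ : exceeds B ts x k = \bigcup_(j in [set j | (j <= k)%N])
    [set w | x < `|B (ts j) w|]).
  by apply: bigcup_measurable => j _; exact: measurable_abs_gt.
by apply/seteqP; split => w [j]; exists j.
Qed.

(** Decomposing by the first passage index, passages up to index n cost at most [2 * P F]. An
    exceedance at the last index is F itself, whence 3 = 2 + 1. *)
Lemma exceeds_prob_le (ts : nat -> R) (x : R) n : ts 0%N = 0 ->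
  {homo ts : i j / (i < j)%N >-> i < j} -> 0 <= x ->
  (P (exceeds B ts x n.+1) <= 3%:E * P [set w | (x < `|B (ts n.+1) w|)%R])%E.
Proof.
move=> t0 tlt x0.
have ts0 i : 0 <= ts i.
  have [->|i0] := posnP i; first by rewrite t0.
  by rewrite -t0 ltW ?tlt.
set F := [set w | _].
have mF : measurable F by exact: measurable_abs_gt.
have mE k : measurable (exceeds B ts x k) by exact: measurable_exceeds.
have first k : (k <= n)%N ->
    (P (exceeds B ts x k) <= 2%:E * P (exceeds B ts x k `&` F))%E.
  elim: k => [|k IH] kn.
    apply: (passage_prob_le t0 tlt x0 (k := 0%N)) => //.
      exact: sigma_rectangles_exceeds.
    by move=> w [j] /=; rewrite leqn0 => /eqP ->.
  (* A is the event that the first passage happens at index [k.+1]; it depends only on the first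
     [k.+1] increments. *)
  pose A := exceeds B ts x k.+1 `\` exceeds B ts x k.
  have mA : measurable A by exact: measurableD.
  have EkA : exceeds B ts x k.+1 = exceeds B ts x k `|` A.
    rewrite /A setDUK// => w [j jk xj].
    by exists j => //; exact: leq_trans (leqnSn k).
  have hA : (P A <= 2%:E * P (A `&` F))%E.
    apply: (passage_prob_le t0 tlt x0 (k := k.+1)) => //.
      set GT := g_sigma_algebraType (rectangles (increment B ts) k.+1).
      by apply: (@measurableD _ GT); exact: sigma_rectangles_exceeds.
    move=> w [[j] + xj Ek]; rewrite leq_eqVlt => /predU1P[<-//|jk].
    by exfalso; apply: Ek; exists j.
  have disjA : exceeds B ts x k `&` A = set0 by rewrite /A setDIK.
  rewrite EkA measureU// setIUl measureU; [| | |]; last first.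
  - by rewrite setIACA disjA set0I.
  - exact: measurableI.
  - exact: measurableI.
  - rewrite muleDr ?ge0_adde_def ?inE//; apply: leeD => //.
    exact/IH/ltnW.
apply: (@le_trans _ _ (P (exceeds B ts x n) + P F)%E).
  apply: (@le_trans _ _ (P (exceeds B ts x n `|` F))); last exact: measureU2.
  apply: le_measure; rewrite ?inE//; first exact: measurableU.
  move=> w [j]; rewrite leq_eqVlt => /predU1P[->|jn]; first by right.
  by left; exists j.
rewrite (_ : 3 = 2 + 1)%R; last by ring.
rewrite EFinD ge0_muleDl// mul1e leeD2r// (le_trans (first _ (leqnn n)))//.
rewrite lee_wpmul2l//; apply: le_measure; rewrite ?inE//.
exact: measurableI.
Qed.

(** * The maximal inequality for continuous paths *)

Lemma brownian_tail (u x : R) : 0 < u -> 0 <= x ->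
  (P [set w | (x < `|B u w|)%R] <= (2 * expR (- x ^+ 2 / (u *+ 2)))%:E)%E.
Proof.
move=> u0 x0; case: (bmB) => _ B0 _ _.
have mx := measurable_norm_gt x.
(* With k = 0 the monotonicity condition is vacuous, so a constant sequence will do: [B u] is the
   increment from time 0. *)
pose ts (i : nat) : R := 0.
have sT : <<s rectangles (increment B ts) 0%N >> setT.
  by apply: sub_sigma_algebra; exact: rectangles_setT.
have tlt i : (i < 0)%N -> ts i < ts i.+1 by [].
have := increment_independent (lexx 0) tlt u0 mx sT.
rewrite setTI probability_setT mule1 /ts subr0.
have -> : [set w | [set r | x < `|r|] (B u w - B 0 w)] = [set w | x < `|B u w|].
  by apply/funext => w /=; rewrite B0 subr0.
move=> ->; rewrite -[in leRHS](@sqr_sqrtr _ u (ltW u0)).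
by apply: normal_prob_tail; rewrite ?sqrtr_gt0.
Qed.

Lemma measurable_path_exceeds (u x : R) :
  0 < u -> measurable (path_exceeds B u x).
Proof.
move=> u0; apply: bigcup_measurable => m _.
by apply: measurable_exceeds => j; exact: dyadic_ge0.
Qed.

(** The dyadic grids are nested and all end at u, so the grid bound, uniform in m, passes to the
    increasing union. The constant is 3 from the maximal inequality times 2 from the two-sided
    tail. *)
Lemma path_exceeds_prob_le (u x : R) : 0 < u -> 0 <= x ->
  (P (path_exceeds B u x) <= (6 * expR (- x ^+ 2 / (u *+ 2)))%:E)%E.
Proof.
move=> u0 x0.
pose F m := exceeds B (dyadic u m) x (2 ^ m)%N.
have mF m : measurable (F m).
  by apply: measurable_exceeds => j; exact: dyadic_ge0.
have ndF : nondecreasing_seq F.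
  apply/nondecreasing_seqP => m; apply/subsetPset => w [j jm xj].
  exists (2 * j)%N; first by rewrite expnS leq_mul2l.
  rewrite (_ : dyadic u m.+1 (2 * j) = dyadic u m j)//.
  by rewrite /dyadic natrM exprS invfM; field.
have cF := nondecreasing_cvg_mu (mu := P) mF (bigcupT_measurable _ mF) ndF.
rewrite -(cvg_lim _ cF)//; apply: lime_le.
  by apply/cvg_ex; eexists; exact: cF.
apply: nearW => m /=.
have m0 : (0 < 2 ^ m)%N by rewrite expn_gt0.
rewrite /F -(prednK m0).
apply: (le_trans (exceeds_prob_le _ _ _ x0)).
- by rewrite /dyadic mul0r.
- by move=> i j ij; rewrite /dyadic ltr_pM2r ?ltr_nat// divr_gt0// exprn_gt0.
rewrite (prednK m0) (_ : dyadic u m (2 ^ m)%N = u); last first.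
  by rewrite /dyadic natrX mulrCA divff ?mulr1// expf_neq0.
rewrite (_ : 6 = 3 * 2)%R; last by ring.
rewrite -mulrA EFinM lee_wpmul2l//; exact: brownian_tail.
Qed.

(** The inequality is strict, so by path continuity it persists at dyadic times close enough to
    t. *)
Lemma path_exceedsP (u x t : R) w : 0 < u -> 0 <= t <= u -> x < `|B t w| ->
  path_exceeds B u x w.
Proof.
move=> u0 tu xt; case: (bmB) => _ _ cB _.
have t0 : 0 <= t by case/andP: tu.
have e0 : 0 < `|B t w| - x by rewrite subr_gt0.
have /subspace_continuousP/(_ t t0)/cvgrPdist_lt/(_ _ e0) := cB w.
rewrite /prop_near1/= nbhs_filterE/= => /nbhs_ballP[del /= del0 hdel].
have [m [j [jm tj]]] := dyadic_approx u0 tu del0.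
exists m => //; exists j => //.
have := hdel _ tj (dyadic_ge0 m j u0).
have := ler_dist_dist (B t w) (B (dyadic u m j) w).
rewrite ler_norml; lra.
Qed.

Lemma path_continuous_gt0 w t : 0 < t -> {for t, continuous (B ^~ w)}.
Proof.
move=> t0; case: (bmB) => _ _ cB _.
have /subspace_continuousP/(_ t (ltW t0)) := cB w.
move=> h A /h hA.
have {}hA : \forall s \near t, 0 <= s -> A (B s w) := hA.
change (\forall s \near t, A (B s w)).
have gt0 : \forall s \near t, 0 < s.
  exact: (@cvgr_gt R R (nbhs t) _ id t _ 0 t0).
by apply: filterS2 hA gt0 => s hs /ltW.
Qed.

(** * Measurability of the supremum event *)

(** If some time t > 0 beats y, continuity at t provides a rational time that does too, so the event
    is a countable union. *)
Lemma measurable_sup_event (g : R -> R) (y : R) :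
  {in `]0, +oo[, continuous g} ->
  measurable [set w | (y%:E < ereal_sup
    ((fun t => ((B t w) ^+ 2 / t - g t)%:E) @` [set t : R | (0 < t)%R]))%E].
Proof.
move=> cg.
rewrite (_ : [set w | _] = \bigcup_(q : rat) [set w | 0 < ratr q :> R /\
    y < (B (ratr q) w) ^+ 2 / ratr q - g (ratr q)]).
  apply: bigcupT_measurable_rat => q.
  have [q0|q0] := ltP 0 (ratr q : R); last first.
    rewrite [X in measurable X](_ : _ = set0)//.
    by apply/seteqP; split => // w [].
  case: (bmB) => mB _ _ _.
  have : measurable_fun setT
      (fun w => (B (ratr q) w) ^+ 2 / ratr q - g (ratr q)).
    apply: measurable_funB => //; apply: measurable_funM => //.
    by apply: measurable_funX; apply: mB; exact: ltW.
  move=> /(_ measurableT `]y, +oo[%classic); rewrite setTI => mx.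
  rewrite [X in measurable X](_ : _ = (fun w => (B (ratr q) w) ^+ 2 / ratr q
     - g (ratr q)) @^-1` `]y, +oo[); first exact: mx.
  by apply/seteqP; split => w /=; rewrite in_itv/= andbT// => -[].
apply/seteqP; split => w /=; last first.
  move=> [q _ [q0 yq]]; apply: lt_le_trans (ereal_sup_ubound _); last first.
    by exists (ratr q).
  by rewrite lte_fin.
move=> /ereal_sup_gt[_ [t /= t0 <-]]; rewrite lte_fin => yt.
pose f s := (B s w) ^+ 2 / s - g s.
have cf : {for t, continuous f}.
  apply: cvgB; last by apply: cg; rewrite in_itv/= t0.
  apply: cvgM; last by apply: cvgV; rewrite ?gt_eqF//; exact: cvg_id.
  by rewrite /= expr2; apply: cvgM; exact: path_continuous_gt0.
have : \forall s \near t, y < f s /\ 0 < s.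
  have f_gt : \forall s \near t, y < f s by exact: (cvgr_gt _ cf).
  have gt0 : \forall s \near t, 0 < s.
    exact: (@cvgr_gt R R (nbhs t) _ id t _ 0 t0).
  by apply: filterS2 f_gt gt0 => s ys s0; split.
move=> /nbhs_ballP[del /= del0 hdel].
have [q] : exists q : rat, ratr q \in `]t, t + del[.
  by apply: rat_in_itvoo; rewrite ltrDl.
rewrite in_itv/= => /andP[tq qt].
have /hdel[yq q0] : ball t del (ratr q : R).
  by rewrite /ball/= ltr0_norm ?subr_lt0//; lra.
by exists q.
Qed.

(** * A single block *)

(** On the block, [B t ^+ 2 > z * t >= z * (s * u)]; it remains to take square roots. *)
Lemma block_exceeds (s u t z : R) w : 0 < u -> 0 <= s -> 0 <= z ->
  0 < t -> s * u <= t <= u -> z < (B t w) ^+ 2 / t ->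
  path_exceeds B u (Num.sqrt (z * (s * u))) w.
Proof.
move=> u0 s0 z0 t0 /andP[st tu]; rewrite ltr_pdivlMr// => zB.
apply: (path_exceedsP u0 (t := t)); first by rewrite (ltW t0).
rewrite -sqrtr_sqr ltr_sqrt; first by rewrite (le_lt_trans _ zB)// ler_wpM2l.
by rewrite (le_lt_trans _ zB)// mulr_ge0// ltW.
Qed.

Lemma block_prob_le (s u z : R) : 0 < u -> 0 < s -> 0 <= z ->
  (P (path_exceeds B u (Num.sqrt (z * (s * u))))
   <= (6 * expR (- (s / 2 * z)))%:E)%E.
Proof.
move=> u0 s0 z0; apply: (le_trans (path_exceeds_prob_le u0 _)) => //.
rewrite sqr_sqrtr; last by rewrite !mulr_ge0// ltW.
rewrite (_ : - (z * (s * u)) / (u *+ 2) = - (s / 2 * z))//.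
by rewrite -mulr_natr; field; rewrite gt_eqF.
Qed.

End brownian_motion.

(** * The union bound over the blocks *)

Unset Implicit Arguments.

Theorem theoremA1 (R : realType) (d : measure_display) (T : measurableType d)
    (P : probability T R) (B : R -> T -> R) :
  is_standard_BM P B ->
  forall a b : R, 2 < a -> b < 1 / 2 ->
  exists c : R, forall y : R, 0 <= y ->
    (P [set w | y%:E < ereal_sup
          ((fun t : R => ((B t w) ^+ 2 / t - a * ln (1 + `|ln t|))%:E) @` [set t : R | (0 < t)%R])]
     <= (c * expR (- (b * y)))%:E)%E.
Proof.
move=> bmB a b a2 b2.
have [s [s0 s1 sa sb]] : exists s : R,
    [/\ 0 < s, s < 1, 1 < s / 2 * a & b < s / 2].
  have a0 : 0 < a by lra.
  have ia : a^-1 < 2^-1 by rewrite ltf_pV2 ?posrE.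
  have ia0 : 0 < a^-1 by rewrite invr_gt0.
  (* The conditions on s say that [s / 2] lies above both b and [1 / a], and below 1/2. The midpoint
     of m and 1/2 qualifies, and m > 0 makes s positive even for negative b. *)
  pose m := Num.max b a^-1.
  have mb : b <= m by rewrite le_max lexx.
  have ma : a^-1 <= m by rewrite le_max lexx orbT.
  have m2 : m < 2^-1 by rewrite gt_max ia andbT; lra.
  exists (m + 2^-1); split; [lra|lra| |lra].
  by rewrite -[ltLHS](mulVf (lt0r_neq0 a0)) ltr_pM2r//; lra.
pose L := - ln s.
have L0 : 0 < L by rewrite oppr_gt0 ln_lt0// s0.
have sE : s = expR (- L) by rewrite /L opprK lnK.
pose C := 1 + 1 / ((s / 2 * a - 1) * L).
have C0 : 0 <= C.
  by rewrite addr_ge0// divr_ge0// ltW// mulr_gt0// subr_gt0.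
(* 12 is two blocks for each n times the constant 6 of the block bound; C bounds the series. *)
exists (12 * C) => y y0.
pose z (n : nat) := y + a * ln (1 + n%:R * L).
have z0 n : 0 <= z n.
  rewrite addr_ge0// mulr_ge0//; first by lra.
  by rewrite ln_ge0// lerDl mulr_ge0// ltW.
pose G n u := path_exceeds B u (Num.sqrt (z n * (s * u))).
pose H n := G n (expR (n.+1%:R * L)) `|` G n (expR (- (n%:R * L))).
have mG n u : 0 < u -> measurable (G n u).
  exact: (measurable_path_exceeds bmB).
have mH n : measurable (H n) by apply: measurableU; exact/mG/expR_gt0.
set E := [set w | _].
have mE : measurable E.
  exact: (measurable_sup_event bmB y (@continuous_log_barrier R a)).
have EH : E `<=` \bigcup_n H n.
  move=> w /ereal_sup_gt[_ [t /= t0 <-]]; rewrite lte_fin ltrBrDr => yB.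
  (* This n satisfies [n * L <= |ln t| < (n + 1) * L], so the barrier at t is at least the one in
     [z n]. The sign of [ln t] then selects one of the two n-th blocks. *)
  pose n := Num.truncn (`|ln t| / L).
  have /andP[] : n%:R <= `|ln t| / L < n.+1%:R.
    by apply: truncn_itv; rewrite divr_ge0// ltW.
  rewrite ler_pdivlMr// ltr_pdivrMr// => nt tn.
  have zB : z n < (B t w) ^+ 2 / t.
    apply: le_lt_trans yB; rewrite lerD2l ler_wpM2l//; first by lra.
    by rewrite ler_ln ?posrE ?lerD2l// ltr_pwDl// mulr_ge0// ltW.
  exists n => //; have tE : t = expR (ln t) by rewrite lnK.
  have [t1|t1] := leP 0 (ln t); [left|right].
    apply: (block_exceeds bmB (expR_gt0 _) (ltW s0) (z0 n) t0 _ zB).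
    rewrite sE -expRD tE !ler_expR; move: nt tn; rewrite ger0_norm// -natr1.
    by move=> nt tn; apply/andP; split; lra.
  apply: (block_exceeds bmB (expR_gt0 _) (ltW s0) (z0 n) t0 _ zB).
  rewrite sE -expRD tE !ler_expR; move: nt tn; rewrite ltr0_norm// -natr1.
  by move=> nt tn; apply/andP; split; lra.
have PG n u : 0 < u -> (P (G n u) <= (6 * (expR (- (s / 2 * y)) *
     expR (- (s / 2 * a * ln (1 + n%:R * L)))))%:E)%E.
  move=> u0; apply: (le_trans (block_prob_le bmB u0 s0 (z0 n))).
  rewrite -expRD lee_fin ler_pM2l// ler_expR /z; lra.
have PH n : (P (H n) <= (12 * expR (- (s / 2 * y)) *
     expR (- (s / 2 * a * ln (1 + n%:R * L))))%:E)%E.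
  apply: (le_trans (measureU2 _ _ _)); [exact/mG/expR_gt0|exact/mG/expR_gt0|].
  apply: (le_trans (leeD (PG _ _ (expR_gt0 _)) (PG _ _ (expR_gt0 _)))).
  by rewrite -EFinD lee_fin; lra.
have := @measure_sigma_subadditive _ _ _ P E H mH mE EH.
move=> /le_trans; apply.
(* The infinite sum is bounded through its partial sums, uniformly in N. *)
apply: lime_le; first exact: is_cvg_nneseries.
apply: nearW => N /=.
apply: (le_trans (lee_sum _ (fun i _ => PH i))).
rewrite sumEFin lee_fin -mulr_sumr big_mkord.
rewrite mulrAC -[leLHS]mulrA -[leRHS]mulrA ler_pM2l//.
apply: ler_pM => //; rewrite ?expR_ge0//.
- by rewrite sumr_ge0// => i _; exact: expR_ge0.
- exact: sum_log_power_bounded.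
(* The decay rate drops from [s / 2] to b, as [y >= 0]. *)
- by rewrite ler_expR lerN2 ler_wpM2r// ltW.
Qed.
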